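(* Let $n\ge1$. The class of $(\langle\ \rangle;,\mathsf A_1,\dots,\mathsf A_n,\cdot)$-algebras that are representable by injective $n$-ary partial functions is a variety, finitely axiomatised by the following equations (each universally quantified over all element variables occurring in it): (1) $\langle \boldsymbol a; b_1,\dots,\boldsymbol a; b_n\rangle ; c = \boldsymbol a;(\boldsymbol b; c)$; (2) $\boldsymbol\pi; a = a$; (3) $\langle \mathsf A_1^n a\rangle; a = 0$ (i.e. $\langle \mathsf A_1^n a\rangle; a=\langle \mathsf A_1^n b\rangle; b$ for all $a,b$, so that $0$ is a well-defined constant); (4) $\langle a_1,\dots,a_{i-1},0,a_{i+1},\dots,a_n\rangle; b = 0$ for every $i$; (5) $\boldsymbol a; 0 = 0$; (6) $\boldsymbol a;\mathsf A_i b = \langle \mathsf A_1^n(\boldsymbol a; b)\rangle;\langle \mathsf D_1^n a_1\rangle;\cdots;\langle \mathsf D_1^n a_n\rangle; a_i$ for every $i$; (7) $\langle \mathsf D_1^n a\rangle; a = a$; (8) $\mathsf A_i\mathsf A_j a=\mathsf A_i\mathsf A_k a$ for every $i,j,k$; (9) $a\cdot a=a$; (10) $a\cdot b=b\cdot a$; (11) $\boldsymbol a;(b\cdot c)=(\boldsymbol a; b)\cdot(\boldsymbol a; c)$; (12) $\langle \mathsf D_1^n(a\cdot b)\rangle; a=a\cdot b$; (13) $\langle a\bowtie_1 b,\dots,a\bowtie_n b\rangle; a=\langle a\bowtie_1 b,\dots,a\bowtie_n b\rangle; b$; (14) $\big(\boldsymbol\alpha;\mathsf D_i(\boldsymbol\alpha;(a\cdot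 b))\big) +_i \big(\boldsymbol\alpha;\langle \mathsf A_1^n(\boldsymbol\alpha; a)\rangle;\mathsf A_i(\boldsymbol\alpha; b)\big)=\boldsymbol\alpha;(a\bowtie_i b)$ for every $i$, where $\boldsymbol\alpha=\langle \mathsf A_1 d,\dots,\mathsf A_n d\rangle$ with $d$ an arbitrary element; (15) $\big(\langle \mathsf D_1^n a\rangle;(b\bowtie_i c)\big)+_i\big(\langle \mathsf A_1^n a\rangle;(b\bowtie_i c)\big)=b\bowtie_i c$ for every $i$; (16) $\langle \mathsf D_1^n((\boldsymbol b; a)\cdot(\boldsymbol c; a))\rangle;\mathsf A_i(b_i\bowtie_i c_i)=0$ for every $i$.
   Context: Fix $n\ge 1$; indices $i,j,k$ range over $\{1,\dots,n\}$. The signature has an $(n+1)$-ary operation (composition), written $\langle a_1,\dots,a_n\rangle ; b$, unary operations $\mathsf A_1,\dots,\mathsf A_n$, and a binary operation $\cdot$. Algebras are nonempty. An $n$-ary partial function on a set $X$ is a set $f\subseteq X^{n+1}$ such that $(\boldsymbol x,y),(\boldsymbol x,z)\in f$ implies $y=z$ (where $\boldsymbol x\in X^n$); it is injective if $(\boldsymbol x,z),(\boldsymbol y,z)\in f$ implies $\boldsymbol x=\boldsymbol y$. An algebra of $n$-ary partial functions of this signature is an algebra whose elements are $n$-ary partial functions, for which there are a set $X$ (the base) and an equivalence relation $E$ on $X$ such that every tuple $(x_1,\dots,x_{n+1})$ in every element lies in $X^{n+1}$ and has pairwise $E$-equivalent entries, and whose operations are $\boldsymbol f; g=\{(\boldsymbol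 x,z)\in X^{n+1} : \exists \boldsymbol y\in X^n,\ (\boldsymbol x,y_i)\in f_i \text{ for each } i \text{ and } (\boldsymbol y,z)\in g\}$, $\mathsf A_i(f)=\{(\boldsymbol x,x_i)\in X^{n+1} : x_1,\dots,x_n \text{ all } E\text{-equivalent and there is no } y\in X \text{ with } (\boldsymbol x,y)\in f\}$, $f\cdot g=f\cap g$. An algebra is representable by injective $n$-ary partial functions if it is isomorphic to an algebra of $n$-ary partial functions of the same signature all of whose elements are injective. Notation: a bold symbol $\boldsymbol a$ in a term $\boldsymbol a; b$ stands for $\langle a_1,\dots,a_n\rangle$; unbracketed compositions associate to the right ($\boldsymbol a;\boldsymbol b; c=\boldsymbol a;(\boldsymbol b; c)$); for unary operations $\mathsf B_1,\dots,\mathsf B_n$, $\langle \mathsf B_1^n a\rangle$ means $\langle \mathsf B_1 a,\dots,\mathsf B_n a\rangle$. Abbreviations: $0:=\langle \mathsf A_1^n b\rangle; b$ for any $b$; $\pi_i:=\mathsf A_i 0$; $\boldsymbol\pi:=\langle\pi_1,\dots,\pi_n\rangle$; $\mathsf D_i a:=\mathsf A_i\mathsf A_i a$; $\alpha+_i\beta:=\mathsf A_i(\langle \mathsf A_1^n\alpha\rangle;\mathsf A_i\beta)$; $a\bowtie_i b:=\mathsf D_i(a\cdot b)+_i(\langle \mathsf A_1^n a\rangle;\mathsf A_i b)$. *)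

(* Defs.v *)
(* [set T] is [T -> Prop]; with the functional and propositional extensionality
   of [boolp], [=] on sets and on tuples ['I_n -> X] is extensional. *)
From mathcomp Require Import all_boot.
From mathcomp Require Import boolp classical_sets.
From Stdlib Require Import RelationClasses.
From Stdlib Require List.

Set Implicit Arguments.
Unset Strict Implicit.
Unset Printing Implicit Defensive.

Local Open Scope classical_set_scope.

(** * Algebras of the signature and their classes *)

Record algebra (n : nat) := Algebra {
  carrier :> Type;
  alg_comp : ('I_n -> carrier) -> carrier -> carrier;
  alg_anti : 'I_n -> carrier -> carrier;
  alg_meet : carrier -> carrier -> carrier;
  carrier_inhabited : inhabited carrier }.

Definition hom (n : nat) (A B : algebra n) (h : A -> B) : Prop :=
  [/\ forall (a : 'I_n -> A) (b : A),
        h (alg_comp a b) = alg_comp (fun i => h (a i)) (h b),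
      forall (i : 'I_n) (a : A), h (alg_anti i a) = alg_anti i (h a) &
      forall a b : A, h (alg_meet a b) = alg_meet (h a) (h b)].

Definition isomorphic (n : nat) (A B : algebra n) : Prop :=
  exists h : A -> B, hom h /\ bijective h.

Lemma prod_inhabited (n : nat) (I : Type) (A : I -> algebra n) :
  inhabited (forall i, A i).
Proof.
apply: inhabits => i.
have /cid[x _] : exists x : A i, True.
  by case: (carrier_inhabited (A i)) => x; exists x.
exact: x.
Qed.

Definition prod_algebra (n : nat) (I : Type) (A : I -> algebra n) : algebra n :=
  @Algebra n (forall i, A i)
    (fun a b i => alg_comp (fun k => a k i) (b i))
    (fun k a i => alg_anti k (a i))
    (fun a b i => alg_meet (a i) (b i))
    (prod_inhabited A).

(* Closure under homomorphic images, subalgebras (as domains of embeddings)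
   and arbitrary products, the empty product included. *)
Definition variety (n : nat) (K : algebra n -> Prop) : Prop :=
  [/\ forall (A B : algebra n) (h : A -> B),
        hom h -> (forall b, exists a, h a = b) -> K A -> K B,
      forall (A B : algebra n) (h : A -> B),
        hom h -> injective h -> K B -> K A &
      forall (I : Type) (A : I -> algebra n),
        (forall i, K (A i)) -> K (prod_algebra A)].

(** * Algebras of partial functions *)

Section PartialFunctions.
Variables (n : nat) (X : Type).

(* A subset of X^(n+1), the last coordinate being split off. *)
Definition pgraph := set (('I_n -> X) * X).

Definition partial_function (f : pgraph) : Prop :=
  forall x y z, f (x, y) -> f (x, z) -> y = z.

Definition injective_pfun (f : pgraph) : Prop :=
  forall x y z, f (x, z) -> f (y, z) -> x = y.

Variable E : X -> X -> Prop.

Definition all_equivalent (x : 'I_n -> X) : Prop := forall i j, E (x i) (x j).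

Definition within (f : pgraph) : Prop :=
  forall x y, f (x, y) -> all_equivalent x /\ forall i, E (x i) y.

Definition pcomp (f : 'I_n -> pgraph) (g : pgraph) : pgraph :=
  [set p | exists y : 'I_n -> X, (forall i, f i (p.1, y i)) /\ g (y, p.2)].

Definition panti (i : 'I_n) (f : pgraph) : pgraph :=
  [set p | [/\ p.2 = p.1 i, all_equivalent p.1 & ~ exists y, f (p.1, y)]].

Record pfun_family := PfunFamily {
  pmem : set pgraph;
  pmem_inhabited : inhabited {f : pgraph | pmem f};
  pmem_pfun : forall f, pmem f -> partial_function f;
  pmem_within : forall f, pmem f -> within f;
  pmem_comp : forall (f : 'I_n -> pgraph) (g : pgraph),
    (forall i, pmem (f i)) -> pmem g -> pmem (pcomp f g);
  pmem_anti : forall (i : 'I_n) (f : pgraph), pmem f -> pmem (panti i f);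
  pmem_meet : forall f g : pgraph, pmem f -> pmem g -> pmem (f `&` g) }.

Definition pfun_algebra (F : pfun_family) : algebra n :=
  @Algebra n {f : pgraph | pmem F f}
    (fun f g => exist _ (pcomp (fun i => proj1_sig (f i)) (proj1_sig g))
       (pmem_comp (fun i => proj2_sig (f i)) (proj2_sig g)))
    (fun i f => exist _ (panti i (proj1_sig f)) (pmem_anti i (proj2_sig f)))
    (fun f g => exist _ (proj1_sig f `&` proj1_sig g)
       (pmem_meet (proj2_sig f) (proj2_sig g)))
    (pmem_inhabited F).

End PartialFunctions.

(* The base X may be empty: the one-element algebra is represented by the
   empty function on the empty base, and only so. *)
Definition injectively_representable (n : nat) (A : algebra n) : Prop :=
  exists (X : Type) (E : X -> X -> Prop) (F : pfun_family n E),
    [/\ Equivalence E,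
        forall f, pmem F f -> injective_pfun f &
        isomorphic A (pfun_algebra F)].

(** * Terms and equations *)

(* [Elem m] is a variable on its own; [Entry m i] is the i-th entry of the
   bold variable number m. *)
Inductive var (n : nat) := Elem of nat | Entry of nat & 'I_n.

Inductive term (n : nat) :=
  | Var of var n
  | Comp of ('I_n -> term n) & term n
  | Anti of 'I_n & term n
  | Meet of term n & term n.

Arguments Elem {n}.

Fixpoint eval (n : nat) (A : algebra n) (v : var n -> A) (t : term n) : A :=
  match t with
  | Var x => v x
  | Comp a b => alg_comp (fun i => eval v (a i)) (eval v b)
  | Anti i a => alg_anti i (eval v a)
  | Meet a b => alg_meet (eval v a) (eval v b)
  end.

Record equation (n : nat) := Equation { lhs : term n; rhs : term n }.

Definition satisfies (n : nat) (A : algebra n) (e : equation n) : Prop :=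
  forall v : var n -> A, eval v (lhs e) = eval v (rhs e).

Definition axiomatised_by (n : nat) (K : algebra n -> Prop)
    (es : seq (equation n)) : Prop :=
  forall A : algebra n, K A <-> List.Forall (@satisfies n A) es.

Declare Scope term_scope.
Delimit Scope term_scope with term.
Bind Scope term_scope with term.
Notation "a ;; b" := (Comp a b) (at level 55, right associativity) : term_scope.
Notation "a * b" := (Meet a b) : term_scope.
Notation "s == t" := (Equation s t) : term_scope.

Section Laws.
Variable n : nat.
Local Open Scope term_scope.
Implicit Types (s t : term n) (i j k : 'I_n).

Definition Antis t : 'I_n -> term n := fun i => Anti i t.

(* The element b in 0 := <A_1 b, ..., A_n b>; b is a variable that occurs
   nowhere else in the axioms. *)
Definition Zero : term n := Antis (Var (Elem 4)) ;; Var (Elem 4).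
Definition Pi : 'I_n -> term n := fun i => Anti i Zero.
Definition Dom i t : term n := Anti i (Anti i t).
Definition Doms t : 'I_n -> term n := fun i => Dom i t.
Definition Plus i s t : term n := Anti i (Antis s ;; Anti i t).
Definition Bowtie i s t : term n :=
  Plus i (Dom i (s * t)) (Antis s ;; Anti i t).

Local Definition a : term n := Var (Elem 0).
Local Definition b : term n := Var (Elem 1).
Local Definition c : term n := Var (Elem 2).
Local Definition d : term n := Var (Elem 3).
Local Definition va : 'I_n -> term n := fun i => Var (Entry 0 i).
Local Definition vb : 'I_n -> term n := fun i => Var (Entry 1 i).
Local Definition vc : 'I_n -> term n := fun i => Var (Entry 2 i).
Local Definition alpha : 'I_n -> term n := Antis d.

Definition ax1 := (fun i => va ;; vb i) ;; c == va ;; vb ;; c.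
Definition ax2 := Pi ;; a == a.
Definition ax3 := Antis a ;; a == Zero.
Definition ax4 i := (fun j => if (j == i)%B then Zero else va j) ;; b == Zero.
Definition ax5 := va ;; Zero == Zero.
Definition ax6 i :=
  va ;; Anti i b ==
  Antis (va ;; b) ;; foldr (fun k t => Doms (va k) ;; t) (va i) (enum 'I_n).
Definition ax7 := Doms a ;; a == a.
Definition ax8 i j k := Anti i (Anti j a) == Anti i (Anti k a).
Definition ax9 := a * a == a.
Definition ax10 := a * b == b * a.
Definition ax11 := va ;; (b * c) == (va ;; b) * (va ;; c).
Definition ax12 := Doms (a * b) ;; a == a * b.
Definition ax13 :=
  (fun i => Bowtie i a b) ;; a == (fun i => Bowtie i a b) ;; b.
Definition ax14 i :=
  Plus i (alpha ;; Dom i (alpha ;; (a * b)))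
         (alpha ;; Antis (alpha ;; a) ;; Anti i (alpha ;; b))
  == alpha ;; Bowtie i a b.
Definition ax15 i :=
  Plus i (Doms a ;; Bowtie i b c) (Antis a ;; Bowtie i b c) == Bowtie i b c.
Definition ax16 i :=
  Doms ((vb ;; a) * (vc ;; a)) ;; Anti i (Bowtie i (vb i) (vc i)) == Zero.

Definition axioms : seq (equation n) :=
  [:: ax1; ax2; ax3] ++ [seq ax4 i | i <- enum 'I_n] ++
  [:: ax5] ++ [seq ax6 i | i <- enum 'I_n] ++
  [:: ax7] ++
  flatten [seq [seq ax8 i j k | j <- enum 'I_n, k <- enum 'I_n] | i <- enum 'I_n] ++
  [:: ax9; ax10; ax11; ax12; ax13] ++
  [seq ax14 i | i <- enum 'I_n] ++ [seq ax15 i | i <- enum 'I_n] ++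
  [seq ax16 i | i <- enum 'I_n].

End Laws.

(* Main.v *)
Require Import Defs.
From mathcomp Require Import all_boot.
From mathcomp Require Import boolp classical_sets.
From Stdlib Require Import RelationClasses.
From Stdlib Require List.

Set Implicit Arguments.
Unset Strict Implicit.
Unset Printing Implicit Defensive.

Local Open Scope classical_set_scope.

(** Soundness. In an algebra of partial functions with base equivalence E,
    every A_i f is the i-th projection restricted to those E-constant tuples
    that satisfy a condition, and composing with a full tuple of such
    restricted projections only restricts the domain.  All the derived terms
    (D_i, the join +_i, the agreement a |><|_i b) are thus restricted
    projections, and most laws become Boolean identities between conditions;
    [sound16] is where injectivity is needed.

    Completeness. Write [off p x] for <A_1 p, ..., A_n p> ; x and [on p x] for
    <D_1 p, ..., D_n p> ; x: the restrictions of x outside and inside the domain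
    of p.  The agreement laws give [eq_cases]: elements equal outside and inside
    the domain of p are equal.  This case distinction is what makes the
    operators [off p], [on p] behave like complementary commuting restrictions
    ([offC], [on_neg], [on_off_dom]), so that domains form a Boolean algebra.

    An ultrafilter of domains is encoded by the set U of the elements whose
    domain it contains.  Two elements have the same germ at U when they agree
    on some domain in U.  The base of the representation consists of the pairs
    (U, germ at U of some a in U), two points being equivalent when they have
    the same U, and a is sent to the function
        ([b_1]_U, ..., [b_n]_U) |-> [<b_1, ..., b_n> ; a]_U,
    defined when <b_1, ..., b_n> ; a is in U.  Superassociativity turns
    composition into composition of functions, the twisted law for antidomain
    ([comp_anti]) gives antidomain, distributivity over meet ([comp_meet])
    gives intersection.  The map is injective because if a . b differs from a,
    some ultrafilter contains the domain of a but not that of a . b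
    ([separating_ultrafilter]); the last law says exactly that each of
    the functions is injective ([same_germ_cancel]).

    A class that is axiomatised by equations is a variety. *)

(** * Equational classes are varieties *)

Section Equational.
Variable n : nat.

Lemma eval_hom (A B : algebra n) (h : A -> B) (v : var n -> A) (t : term n) :
  hom h -> h (eval v t) = eval (h \o v) t.
Proof.
case=> hC hA hM; elim: t => [x|a IHa b IHb|i a IHa|a IHa b IHb] //=.
- by rewrite hC IHb; congr alg_comp; apply/funext => i; exact: IHa.
- by rewrite hA IHa.
- by rewrite hM IHa IHb.
Qed.

Lemma satisfies_surj (A B : algebra n) (h : A -> B) (e : equation n) :
  hom h -> (forall b, exists a, h a = b) -> satisfies A e -> satisfies B e.
Proof.
move=> hh hsurj sat v.
have [w hw] := choice (fun x => hsurj (v x)).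
have -> : v = h \o w by apply/funext => x; rewrite /= hw.
by rewrite -!eval_hom // sat.
Qed.

Lemma satisfies_inj (A B : algebra n) (h : A -> B) (e : equation n) :
  hom h -> injective h -> satisfies B e -> satisfies A e.
Proof. by move=> hh hinj sat v; apply: hinj; rewrite !eval_hom. Qed.

Lemma eval_prod (I : Type) (A : I -> algebra n) (v : var n -> prod_algebra A)
    (t : term n) (i : I) :
  eval v t i = eval (fun x => v x i) t.
Proof.
elim: t => [x|a IHa b IHb|k a IHa|a IHa b IHb] //=.
- by rewrite IHb; congr alg_comp; apply/funext => k; exact: IHa.
- by rewrite IHa.
- by rewrite IHa IHb.
Qed.

Lemma satisfies_prod (I : Type) (A : I -> algebra n) (e : equation n) :
  (forall i, satisfies (A i) e) -> satisfies (prod_algebra A) e.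
Proof.
move=> sat v; apply: functional_extensionality_dep => i.
by rewrite !eval_prod sat.
Qed.

Lemma variety_of_axioms (K : algebra n -> Prop) (es : seq (equation n)) :
  axiomatised_by K es -> variety K.
Proof.
move=> KE; split.
- move=> A B h hh hsurj /KE KA; apply/KE.
  by apply: List.Forall_impl KA => e; exact: satisfies_surj hh hsurj.
- move=> A B h hh hinj /KE KB; apply/KE.
  by apply: List.Forall_impl KB => e; exact: satisfies_inj hh hinj.
- move=> I A KA; apply/KE/List.Forall_forall => e ein.
  by apply: satisfies_prod => i; have /KE/List.Forall_forall := KA i; exact.
Qed.

End Equational.

(** * The axioms as a list of laws *)

Lemma Forall_map_enum (T : finType) (S : Type) (P : S -> Prop) (f : T -> S) :
  List.Forall P [seq f x | x <- enum T] <-> forall x, P (f x).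
Proof.
split=> [/List.Forall_map all_P x|all_P]; last first.
  by elim: (enum T) => [|x s IHs]; constructor.
have : x \in enum T by rewrite mem_enum.
by elim: all_P => [//|y s Py _ IHs]; rewrite inE => /orP[/eqP->|/IHs].
Qed.

Lemma Forall_cat (T : Type) (P : T -> Prop) (s t : seq T) :
  List.Forall P (s ++ t) <-> List.Forall P s /\ List.Forall P t.
Proof. exact: List.Forall_app. Qed.

Lemma Forall_flatten (S : Type) (P : S -> Prop) (ss : seq (seq S)) :
  List.Forall P (flatten ss) <-> List.Forall (List.Forall P) ss.
Proof. exact: List.Forall_concat. Qed.

Section Models.
Variables (n : nat) (A : algebra n).

(** The list of axioms with each law available by name. *)
Record models : Prop := Models {
  sat1 : satisfies A (ax1 n);
  sat2 : satisfies A (ax2 n);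
  sat3 : satisfies A (ax3 n);
  sat4 : forall i, satisfies A (ax4 i);
  sat5 : satisfies A (ax5 n);
  sat6 : forall i, satisfies A (ax6 i);
  sat7 : satisfies A (ax7 n);
  sat8 : forall i j k, satisfies A (ax8 i j k);
  sat9 : satisfies A (ax9 n);
  sat10 : satisfies A (ax10 n);
  sat11 : satisfies A (ax11 n);
  sat12 : satisfies A (ax12 n);
  sat13 : satisfies A (ax13 n);
  sat14 : forall i, satisfies A (ax14 i);
  sat15 : forall i, satisfies A (ax15 i);
  sat16 : forall i, satisfies A (ax16 i) }.

Lemma Forall_ax8 (P : equation n -> Prop) :
  List.Forall P (flatten [seq [seq ax8 i j k | j <- enum 'I_n, k <- enum 'I_n]
    | i <- enum 'I_n]) <-> forall i j k, P (ax8 i j k).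
Proof.
rewrite Forall_flatten Forall_map_enum.
split=> P8 i; last first.
  by rewrite Forall_flatten Forall_map_enum => j; rewrite Forall_map_enum.
move=> j k; have := P8 i; rewrite Forall_flatten Forall_map_enum.
by move=> /(_ j); rewrite Forall_map_enum => /(_ k).
Qed.

Lemma modelsP : List.Forall (@satisfies n A) (axioms n) <-> models.
Proof.
rewrite /axioms !Forall_cat !Forall_map_enum Forall_ax8.
rewrite !List.Forall_cons_iff.
split=> [|[*]]; last by do !split.
by move=> ?; split; tauto.
Qed.

End Models.

(** * Soundness *)

(* The unqualified name denotes the composition of option-valued functions. *)
Local Notation pcomp := Defs.pcomp.

Section Soundness.
Variables (n : nat) (i0 : 'I_n) (X : Type) (E : X -> X -> Prop).
Implicit Types (f g : pgraph n X) (S T : set ('I_n -> X)) (i j : 'I_n).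

Definition dom f : set ('I_n -> X) := [set x | exists y, f (x, y)].

Definition subproj i S : pgraph n X :=
  [set p | [/\ p.2 = p.1 i, all_equivalent E p.1 & S p.1]].

Definition restr S f : pgraph n X := [set p | S p.1 /\ f p].

Lemma panti_subproj i f : panti E i f = subproj i (~` dom f).
Proof. by []. Qed.

Lemma panti_panti i j f : panti E i (panti E j f) = subproj i (dom f).
Proof.
rewrite 2!panti_subproj predeqE => -[x y] /=.
split=> -[/= -> xE xf]; split => //.
  by apply: contra_notP xf => xf; exists (x j).
by case=> z [].
Qed.

Lemma panti_sub i j S : panti E i (subproj j S) = subproj i (~` S).
Proof.
rewrite panti_subproj predeqE => -[x y] /=.
split=> -[/= -> xE xf]; split => //.
  by apply: contra_not xf => xf; exists (x j).
by case=> z [].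
Qed.

Lemma within_subproj i S : within E (subproj i S).
Proof. by move=> x y [/= -> xE _]; split. Qed.

(** On tuples of restricted projections the intermediate tuple of a composition
    is the argument itself; f only relates E-constant tuples, which is what the
    restricted projections ask for. *)
Lemma pcomp_subproj S f :
  within E f -> pcomp (fun i => subproj i S) f = restr S f.
Proof.
move=> wf; rewrite predeqE => -[x z]; split.
  move=> [y [/= xy yz]]; have yE : y = x by apply/funext => i; case: (xy i).
  by rewrite -yE in xy *; split=> //; case: (xy i0).
move=> [/= Sx xz]; exists x; split=> // i; split=> //.
by have [] := wf _ _ xz.
Qed.

Lemma pcomp_anti f g : within E g ->
  pcomp (fun j => panti E j f) g = restr (~` dom f) g.
Proof. exact: pcomp_subproj. Qed.

Lemma pcomp_dom f g : within E g ->
  pcomp (fun j => panti E j (panti E j f)) g = restr (dom f) g.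
Proof.
move=> wg; rewrite -pcomp_subproj //; congr pcomp.
by apply/funext => j; exact: panti_panti.
Qed.

Lemma restr_subproj i S T : restr S (subproj i T) = subproj i (S `&` T).
Proof.
by rewrite predeqE => -[x y]; split=> [[/= ? []]|[/= ? ? []]].
Qed.

Lemma dom_restr S f : dom (restr S f) = S `&` dom f.
Proof.
rewrite predeqE => x; split=> [[y [/= Sx xy]]|[Sx [y xy]]]; last by exists y.
by split=> //; exists y.
Qed.

Definition pdom i f := panti E i (panti E i f).

Definition pplus i f g :=
  panti E i (pcomp (fun j => panti E j f) (panti E i g)).

Definition pbowtie i f g :=
  pplus i (pdom i (f `&` g)) (pcomp (fun j => panti E j f) (panti E i g)).

Lemma pplus_subproj i S T :
  pplus i (subproj i S) (subproj i T) = subproj i (S `|` T).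
Proof.
rewrite /pplus panti_sub.
have -> : (fun j => panti E j (subproj i S)) = fun j => subproj j (~` S).
  by apply/funext => j; rewrite panti_sub.
rewrite pcomp_subproj ?restr_subproj; last exact: within_subproj.
by rewrite panti_sub setCI !setCK.
Qed.

(** Where f and g are both undefined they agree as well. *)
Definition agree f g : set ('I_n -> X) :=
  dom (f `&` g) `|` (~` dom f `&` ~` dom g).

Lemma pbowtie_subproj i f g : pbowtie i f g = subproj i (agree f g).
Proof.
rewrite /pbowtie /pdom panti_panti panti_subproj.
rewrite pcomp_anti; last exact: within_subproj.
by rewrite restr_subproj pplus_subproj.
Qed.

Lemma pcomp_anti_self f : within E f -> pcomp (fun i => panti E i f) f = set0.
Proof.
move=> wf; rewrite pcomp_anti // predeqE => -[x z]; split=> // -[/= xf xz].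
by apply: xf; exists z.
Qed.

End Soundness.

Section SoundnessAxioms.
Variables (n : nat) (i0 : 'I_n) (X : Type) (E : X -> X -> Prop).
Hypothesis E_equiv : Equivalence E.
Variable F : pfun_family n E.
Hypothesis F_inj : forall f, pmem F f -> injective_pfun f.

Variable v : var n -> pfun_algebra F.

Local Notation sem t := (sval (eval v t)).
Implicit Types (s t u : term n) (i : 'I_n).

Let sem_within t : within E (sem t).
Proof. exact: pmem_within (proj2_sig (eval v t)). Qed.

Let sem_pfun t : partial_function (sem t).
Proof. exact: pmem_pfun (proj2_sig (eval v t)). Qed.

Let sem_inj t : injective_pfun (sem t).
Proof. exact: F_inj (proj2_sig (eval v t)). Qed.

Lemma eq_sem s t : sem s = sem t -> eval v s = eval v t.
Proof.
case: (eval v s) => f Ff; case: (eval v t) => g Fg /= fg; exact: eq_exist.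
Qed.

Lemma sem_Comp (a : 'I_n -> term n) t :
  sem (Comp a t) = pcomp (fun i => sem (a i)) (sem t).
Proof. by []. Qed.

Lemma sem_Anti i t : sem (Anti i t) = subproj E i (~` dom (sem t)).
Proof. by []. Qed.

Lemma sem_Dom i t : sem (Dom i t) = subproj E i (dom (sem t)).
Proof. exact: panti_panti. Qed.

Lemma sem_Antis s t : sem (Comp (Antis s) t) = restr (~` dom (sem s)) (sem t).
Proof. exact: pcomp_anti. Qed.

Lemma sem_Doms s t : sem (Comp (Doms s) t) = restr (dom (sem s)) (sem t).
Proof. exact: pcomp_dom. Qed.

Lemma sem_Bowtie i s t :
  sem (Bowtie i s t) = subproj E i (agree (sem s) (sem t)).
Proof. exact: pbowtie_subproj. Qed.

Lemma sem_Bowties s t u :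
  sem (Comp (fun i => Bowtie i s t) u) = restr (agree (sem s) (sem t)) (sem u).
Proof.
rewrite sem_Comp -(pcomp_subproj i0 _ (@sem_within u)); congr pcomp.
by apply/funext => i; exact: sem_Bowtie.
Qed.

Lemma sem_Plus i s t (S T : set ('I_n -> X)) :
  sem s = subproj E i S -> sem t = subproj E i T ->
  sem (Plus i s t) = subproj E i (S `|` T).
Proof. by move=> sS tT; rewrite -pplus_subproj // -sS -tT. Qed.

Lemma sem_Antis_self t : sem (Comp (Antis t) t) = set0.
Proof. exact: (pcomp_anti_self i0 (@sem_within t)). Qed.

Lemma sem_Zero : sem (Zero n) = set0.
Proof. exact: sem_Antis_self. Qed.

Lemma dom_set0 : dom (set0 : pgraph n X) = set0.
Proof. by rewrite predeqE => x; split=> [[]|]. Qed.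

Lemma sound1 : eval v (lhs (ax1 n)) = eval v (rhs (ax1 n)).
Proof.
apply: eq_sem; rewrite predeqE => -[x z]; split.
  move=> [y [/= xy yz]]; have [t tP] := choice xy.
  (* the tuples chosen for different i coincide, as the functions are single
     valued; any of them will do *)
  exists (t i0); split=> [i|]; first by have [] := tP i0.
  exists y; split=> // i /=; have [/= xt ty] := tP i.
  suff -> : t i0 = t i by [].
  apply/funext => j; have [/= xt0 _] := tP i0.
  exact: (@sem_pfun (Defs.va j)) (xt0 j) (xt j).
move=> [y [/= xy [t [/= yt tz]]]]; exists t; split=> // i /=.
by exists y; split.
Qed.

Lemma sound2 : eval v (lhs (ax2 n)) = eval v (rhs (ax2 n)).
Proof.
apply: eq_sem; rewrite [LHS]sem_Antis sem_Zero dom_set0 setC0.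
by rewrite predeqE => p; split=> [[]|].
Qed.

Lemma sound3 : eval v (lhs (ax3 n)) = eval v (rhs (ax3 n)).
Proof.
by apply: eq_sem; rewrite sem_Zero [LHS]sem_Antis_self.
Qed.

Lemma sound4 i : eval v (lhs (ax4 i)) = eval v (rhs (ax4 i)).
Proof.
apply: eq_sem; rewrite sem_Zero predeqE => -[x z]; split=> // -[y [xy _]].
by have := xy i; rewrite eqxx sem_Zero.
Qed.

Lemma sound5 : eval v (lhs (ax5 n)) = eval v (rhs (ax5 n)).
Proof.
apply: eq_sem; rewrite [LHS]sem_Comp !sem_Zero predeqE => -[x z].
by split=> // -[y []].
Qed.

Lemma sem_foldr_Doms (a : 'I_n -> term n) i (r : seq 'I_n) x z :
  sem (foldr (fun k t => Comp (Doms (a k)) t) (a i) r) (x, z) <->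
  (forall k, k \in r -> dom (sem (a k)) x) /\ sem (a i) (x, z).
Proof.
elim: r => [|k r IHr]; first by split=> [|[]].
rewrite sem_Doms; split=> [[/= xk /IHr[xr xz]]|[xr xz]].
  by split=> // j; rewrite inE => /orP[/eqP->|/xr].
split=> /=; first by apply: xr; rewrite inE eqxx.
by apply/IHr; split=> // j jr; apply: xr; rewrite inE jr orbT.
Qed.

Lemma sound6 i : eval v (lhs (ax6 i)) = eval v (rhs (ax6 i)).
Proof.
apply: eq_sem; rewrite [RHS]sem_Antis predeqE => -[x z]; split.
  move=> [y [xy [/= -> yE yb]]]; split=> /=.
    move=> [u [y' [xy' y'u]]]; apply: yb; exists u.
    suff -> : y = y' by [].
    by apply/funext => k; exact: (@sem_pfun (Defs.va k)) (xy k) (xy' k).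
  by apply/sem_foldr_Doms; split=> // k _; exists (y k).
move=> [/= xab /sem_foldr_Doms[xa xz]].
have /choice[y xy] : forall k, dom (sem (Defs.va k)) x.
  by move=> k; apply: xa; rewrite mem_enum.
exists y; split=> //; split=> /=.
- exact: (@sem_pfun (Defs.va i)) xz (xy i).
- move=> j k.
  have [xE xj] := sem_within (xy j); have [_ xk] := sem_within (xy k).
  by transitivity (x i0); [symmetry; exact: xj|exact: xk].
- by move=> [u yu]; apply: xab; exists u, y; split.
Qed.

Lemma sound7 : eval v (lhs (ax7 n)) = eval v (rhs (ax7 n)).
Proof.
apply: eq_sem; rewrite [LHS]sem_Doms predeqE => -[x z].
by split=> [[]//|xz]; split=> //; exists z.
Qed.

Lemma sound8 i j k : eval v (lhs (ax8 i j k)) = eval v (rhs (ax8 i j k)).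
Proof. by apply: eq_sem; rewrite [LHS]panti_panti [RHS]panti_panti. Qed.

Lemma sound9 : eval v (lhs (ax9 n)) = eval v (rhs (ax9 n)).
Proof. by apply: eq_sem; exact: setIid. Qed.

Lemma sound10 : eval v (lhs (ax10 n)) = eval v (rhs (ax10 n)).
Proof. by apply: eq_sem; exact: setIC. Qed.

Lemma sound11 : eval v (lhs (ax11 n)) = eval v (rhs (ax11 n)).
Proof.
apply: eq_sem; rewrite predeqE => -[x z]; split.
  by move=> [y [xy [yb yc]]]; split; exists y; split.
move=> [[y [xy yb]] [y' [xy' yc]]]; exists y; split=> //; split=> //.
suff -> : y = y' by [].
by apply/funext => k; exact: (@sem_pfun (Defs.va k)) (xy k) (xy' k).
Qed.

Lemma sound12 : eval v (lhs (ax12 n)) = eval v (rhs (ax12 n)).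
Proof.
apply: eq_sem; rewrite [LHS]sem_Doms predeqE => -[x z].
split=> [[[y [xa xb]] xz]|[xa xb]]; last by split=> //; exists z.
by have -> : z = y by exact: (@sem_pfun (Defs.a n)) xz xa.
Qed.

Lemma sound13 : eval v (lhs (ax13 n)) = eval v (rhs (ax13 n)).
Proof.
apply: eq_sem; rewrite [LHS]sem_Bowties [RHS]sem_Bowties predeqE => -[x z].
split=> -[/= xag xz]; split=> //=.
  case: xag => [[y [xa xb]]|[xa _]]; last by case: xa; exists z.
  by have -> : z = y by exact: (@sem_pfun (Defs.a n)) xz xa.
case: xag => [[y [xa xb]]|[_ xb]]; last by case: xb; exists z.
by have -> : z = y by exact: (@sem_pfun (Defs.b n)) xz xb.
Qed.

Lemma sound14 i : eval v (lhs (ax14 i)) = eval v (rhs (ax14 i)).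
Proof.
apply: eq_sem; rewrite [RHS]sem_Antis sem_Bowtie restr_subproj.
set S := ~` _; pose f := sem (Defs.a n); pose g := sem (Defs.b n).
rewrite (@sem_Plus i _ _ (S `&` (S `&` dom (f `&` g)))
  (S `&` (~` (S `&` dom f) `&` ~` (S `&` dom g)))).
- congr subproj; rewrite predeqE => x; rewrite /agree /=; split.
    by move=> [[? []]|]; tauto.
  by move=> ?; have [] := EM (S x); tauto.
- by rewrite sem_Antis sem_Dom restr_subproj sem_Antis dom_restr.
- rewrite sem_Antis sem_Antis sem_Anti !restr_subproj.
  by rewrite !sem_Antis !dom_restr.
Qed.

Lemma sound15 i : eval v (lhs (ax15 i)) = eval v (rhs (ax15 i)).
Proof.
apply: eq_sem; rewrite [RHS]sem_Bowtie.
set T := agree _ _; set S := dom (sem (Defs.a n)).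
rewrite (@sem_Plus i _ _ (S `&` T) (~` S `&` T)).
- congr subproj; rewrite predeqE => x /=.
  by have [] := EM (S x); tauto.
- by rewrite sem_Doms sem_Bowtie restr_subproj.
- by rewrite sem_Antis sem_Bowtie restr_subproj.
Qed.

Lemma sound16 i : eval v (lhs (ax16 i)) = eval v (rhs (ax16 i)).
Proof.
apply: eq_sem; rewrite [LHS]sem_Doms sem_Zero sem_Anti sem_Bowtie restr_subproj.
rewrite predeqE => -[x z]; split=> // -[/= _ xE [[u [xu xu']] nag]].
case: xu => y [xy yu]; case: xu' => y' [xy' y'u].
apply: nag; exists (x i); split=> //; left; exists (y i).
split; first exact: xy.
have -> : y = y' by exact: (@sem_inj (Defs.a n)) yu y'u.
exact: xy'.
Qed.

End SoundnessAxioms.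

Lemma pfun_models (n : nat) (i0 : 'I_n) (X : Type) (E : X -> X -> Prop)
    (F : pfun_family n E) :
  Equivalence E -> (forall f, pmem F f -> injective_pfun f) ->
  models (pfun_algebra F).
Proof.
move=> E_equiv F_inj; split=> *; move=> v.
- exact: sound1.
- exact: sound2.
- exact: sound3.
- exact: sound4.
- exact: sound5.
- exact: sound6.
- exact: sound7.
- exact: sound8.
- exact: sound9.
- exact: sound10.
- exact: sound11.
- exact: sound12.
- exact: sound13.
- exact: sound14.
- exact: sound15.
- exact: sound16.
Qed.

(** * Domain calculus in a model of the axioms *)

Section Completeness.
Variables (n : nat) (i0 : 'I_n) (A : algebra n).
Hypothesis A_models : models A.
Implicit Types (a b c p q x y : A) (i j k : 'I_n).

Local Notation comp := (@alg_comp n A).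
Local Notation anti := (@alg_anti n A).
Local Notation "a .* b" := (@alg_meet n A a b)
  (at level 40, left associativity).

Fact exists_elt : exists x : A, True.
Proof. by case: (carrier_inhabited A) => x; exists x. Qed.

Definition some_elt : A := sval (cid exists_elt).

Definition zero : A := comp (fun i => anti i some_elt) some_elt.

Definition off p x : A := comp (fun i => anti i p) x.

(** By the eighth law all A_i p have the same domain, so any index does. *)
Definition neg p : A := anti i0 p.

Definition on p x : A := off (neg p) x.

(** Element variable number 4, from which the constant 0 is built, always gets
    the value [some_elt], so that 0 evaluates to [zero]. *)
Definition valuation (ea eb ec ed : A) (ta tb tc : 'I_n -> A) (z : var n) : A :=
  match z with
  | Elem m => nth some_elt [:: ea; eb; ec; ed] m
  | Entry m i => nth some_elt [:: ta i; tb i; tc i] m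
  end.

Let e0 (i : 'I_n) := some_elt.

Lemma comp_assoc (a b : 'I_n -> A) c :
  comp (fun i => comp a (b i)) c = comp a (comp b c).
Proof. exact: (sat1 A_models (valuation c c c c a b e0)). Qed.

Lemma off_zero x : off zero x = x.
Proof. exact: (sat2 A_models (valuation x x x x e0 e0 e0)). Qed.

Lemma off_self p : off p p = zero.
Proof. exact: (sat3 A_models (valuation p p p p e0 e0 e0)). Qed.

Lemma comp_zero_entry (a : 'I_n -> A) b i : a i = zero -> comp a b = zero.
Proof.
move=> ai; rewrite -[RHS](sat4 A_models i (valuation b b b b a e0 e0)).
rewrite /=; congr comp; apply/funext => j.
by case: eqP => [->|].
Qed.

Lemma comp_zero (a : 'I_n -> A) : comp a zero = zero.
Proof. exact: (sat5 A_models (valuation zero zero zero zero a e0 e0)). Qed.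

Lemma anti_anti i j k p : anti i (anti j p) = anti i (anti k p).
Proof. exact: (sat8 A_models i j k (valuation p p p p e0 e0 e0)). Qed.

Lemma off_ext p q x : (forall i, anti i p = anti i q) -> off p x = off q x.
Proof. by move=> pq; rewrite /off; congr comp; apply/funext. Qed.

Lemma off_anti_neg i p x : off (anti i p) x = on p x.
Proof. by apply: off_ext => j; exact: anti_anti. Qed.

Lemma on_Dom p x : comp (fun i => anti i (anti i p)) x = on p x.
Proof. by congr comp; apply/funext => j; exact: anti_anti. Qed.

Lemma on_self p : on p p = p.
Proof.
by rewrite -on_Dom; exact: (sat7 A_models (valuation p p p p e0 e0 e0)).
Qed.

Lemma comp_anti (a : 'I_n -> A) b i :
  comp a (anti i b) =
  off (comp a b) (foldr (fun k x => on (a k) x) (a i) (enum 'I_n)).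
Proof.
have /= -> := sat6 A_models i (valuation b b b b a e0 e0).
congr comp; elim: (enum 'I_n) => [//|k s /= ->].
exact: on_Dom.
Qed.

Lemma meetxx a : a .* a = a.
Proof. exact: (sat9 A_models (valuation a a a a e0 e0 e0)). Qed.

Lemma meetC a b : a .* b = b .* a.
Proof. exact: (sat10 A_models (valuation a b a a e0 e0 e0)). Qed.

Lemma comp_meet (a : 'I_n -> A) b c : comp a (b .* c) = comp a b .* comp a c.
Proof. exact: (sat11 A_models (valuation b b c b a e0 e0)). Qed.

Lemma on_meet a b : on (a .* b) a = a .* b.
Proof.
by rewrite -on_Dom; exact: (sat12 A_models (valuation a b a a e0 e0 e0)).
Qed.

Definition plus i x y : A := anti i (off x (anti i y)).

Definition bowtie i a b : A :=
  plus i (anti i (anti i (a .* b))) (off a (anti i b)).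

Lemma comp_bowtie a b :
  comp (fun i => bowtie i a b) a = comp (fun i => bowtie i a b) b.
Proof. exact: (sat13 A_models (valuation a b a a e0 e0 e0)). Qed.

Lemma off_bowtie i p a b :
  plus i (off p (anti i (anti i (off p (a .* b)))))
    (off p (off (off p a) (anti i (off p b)))) = off p (bowtie i a b).
Proof. exact: (sat14 A_models i (valuation a b a p e0 e0 e0)). Qed.

Lemma bowtie_cases i p a b :
  plus i (on p (bowtie i a b)) (off p (bowtie i a b)) = bowtie i a b.
Proof.
by rewrite -on_Dom; exact: (sat15 A_models i (valuation p a b p e0 e0 e0)).
Qed.

Lemma bowtie_inj i (b c : 'I_n -> A) a :
  on (comp b a .* comp c a) (anti i (bowtie i (b i) (c i))) = zero.
Proof.
by rewrite -on_Dom; exact: (sat16 A_models i (valuation a a a a e0 b c)).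
Qed.

Lemma off0 p : off p zero = zero.
Proof. exact: comp_zero. Qed.

Lemma off_comp p (a : 'I_n -> A) b :
  off p (comp a b) = comp (fun i => off p (a i)) b.
Proof. by rewrite /off comp_assoc. Qed.

(** The twisted law applied to a tuple of antidomains: the restrictions to the
    domains of the A_k p leave A_i p as it is, all these domains being equal. *)
Lemma off_anti_off p i q : off p (anti i q) = off (off p q) (anti i p).
Proof.
rewrite {1}/off comp_anti; congr off.
elim: (enum 'I_n) => [//|k s /= ->].
rewrite -[RHS]on_self -on_Dom -[RHS]on_Dom; congr comp; apply/funext => j.
by congr anti; exact: anti_anti.
Qed.

Lemma off_off p q x : off p (off q x) = off (off p q) (off p x).
Proof.
rewrite off_comp [RHS]off_comp; congr comp; apply/funext => i.
exact: off_anti_off.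
Qed.

Lemma off_idem p x : off p (off p x) = off p x.
Proof. by rewrite off_off off_self off_zero. Qed.

Lemma off_anti p i : off p (anti i p) = anti i p.
Proof. by rewrite off_anti_off off_self off_zero. Qed.

Lemma on_anti p i : on p (anti i p) = zero.
Proof. by rewrite -(off_anti_neg i) off_self. Qed.

(** Pushing the restriction inside, every entry of the tuple A_1 p, ..., A_n p
    becomes 0, and one zero entry suffices. *)
Lemma on_off p x : on p (off p x) = zero.
Proof.
by rewrite /on off_comp; apply: (@comp_zero_entry _ _ i0); exact: off_self.
Qed.

Lemma off_on p x : off p (on p x) = zero.
Proof. by rewrite /on off_off off_anti; exact: on_off. Qed.

Lemma bowtie_self i a : bowtie i a a = anti i zero.
Proof.
rewrite /bowtie meetxx off_anti /plus (off_anti_neg i).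
by rewrite on_anti.
Qed.

(** The restriction of the agreement of x and y to a domain depends only on the
    restrictions of x and y ([off_bowtie]), hence on both pieces it is that of
    x with itself; the pieces determine it ([bowtie_cases]), so it is
    everything, and elements coincide on their agreement ([comp_bowtie]). *)
Lemma eq_cases p x y : off p x = off p y -> on p x = on p y -> x = y.
Proof.
move=> off_xy on_xy.
suff bow : forall i, bowtie i x y = anti i zero.
  have := comp_bowtie x y.
  by rewrite (_ : (fun i => bowtie i x y) = fun i => anti i zero);
    [rewrite -!/(off _ _) !off_zero|exact/funext].
have local q i : off q x = off q y ->
    off q (bowtie i x y) = off q (bowtie i x x).
  move=> qxy; rewrite -!off_bowtie.
  have -> : off q (x .* y) = off q (x .* x).
    by rewrite /off !comp_meet -!/(off _ _) qxy.
  by rewrite -qxy.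
move=> i; rewrite -(bowtie_self i x).
rewrite -(bowtie_cases i p) -[RHS](bowtie_cases i p).
by rewrite /on !local.
Qed.

Lemma anti_neg_neg i p : anti i (neg (neg p)) = anti i p.
Proof.
apply: (@eq_cases p).
  rewrite off_anti_off; suff -> : off p (neg (neg p)) = zero.
    by rewrite off_zero off_anti.
  by rewrite /neg off_anti_off [off p (anti _ _)]off_anti off_self.
rewrite on_anti /on off_anti_off.
by rewrite [off (neg p) (neg (neg p))]off_anti; exact: on_anti.
Qed.

Lemma on_neg p x : on (neg p) x = off p x.
Proof. by apply: off_ext => i; exact: anti_neg_neg. Qed.

Lemma offC p q x : off p (off q x) = off q (off p x).
Proof.
apply: (@eq_cases p).
  by rewrite off_idem [RHS]off_off off_idem -off_off.
by rewrite on_off /on off_off -/(on p (off p x)) on_off off0.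
Qed.

(** If dom p is contained in dom q, nothing of dom p remains outside dom q. *)
Lemma off_on_below p q x : off q p = zero -> off q (on p x) = zero.
Proof.
move=> qp; rewrite /on off_comp; apply: (@comp_zero_entry _ _ i0).
have -> : off q (anti i0 (neg p)) = off (off q (neg p)) (anti i0 q).
  exact: off_anti_off.
have -> : off q (neg p) = neg q by rewrite /neg off_anti_off qp off_zero.
exact: on_anti.
Qed.

(** The domain of [off p q] is dom q minus dom p: this is what allows elements
    to stand for their domains. *)
Lemma on_off_dom p q x : on (off p q) x = off p (on q x).
Proof.
apply: (@eq_cases p); last first.
  rewrite on_off; apply: off_on_below; exact: on_off.
rewrite off_idem /on [LHS]off_off [RHS]off_off; congr off.
by rewrite /neg [LHS]off_anti_off [RHS]off_anti_off off_idem.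
Qed.

Lemma onC p q x : on p (on q x) = on q (on p x).
Proof. exact: offC. Qed.

(** * Ultrafilters of domains *)

(** A set of elements, to be read as the set of those whose domain belongs to an
    ultrafilter: since [off p q] has domain dom q minus dom p, these two
    conditions express closure under complement, intersection and enlargement,
    and entail that 0 does not belong ([ultra_zero]). *)
Definition ultrafilter (U : set A) : Prop :=
  (forall i p, U (anti i p) <-> ~ U p) /\
  (forall p q, U (off p q) <-> ~ U p /\ U q).

Definition cut (l : seq A) x : A := foldr on x l.

Lemma off_cut p l x : off p (cut l x) = cut l (off p x).
Proof. by elim: l => [//|q l /= <-]; exact: offC. Qed.

Lemma cutC l m x : cut l (cut m x) = cut m (cut l x).
Proof. by elim: m => [//|q m /= <-]; exact/esym/off_cut. Qed.

Lemma cut_zero l : cut l zero = zero.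
Proof. by elim: l => [//|q l /= ->]; exact: off0. Qed.

(** The finite intersection property, relative to dom p0. *)
Definition consistent p0 (S : set A) : Prop :=
  forall l, List.Forall S l -> cut l p0 <> zero.

Lemma consistent_bigcup p0 (C : set (set A)) :
  p0 <> zero -> C `<=` consistent p0 -> total_on C subset ->
  consistent p0 (\bigcup_(S in C) S).
Proof.
move=> p0_neq0 Ccons Ctot l lC.
suff [->//|[S CS lS]] : l = [::] \/ exists2 S, C S & List.Forall S l.
  exact: Ccons CS _ lS.
elim: lC => [|p m [S CS Sp] _ IHm]; [by left|right].
case: IHm => [->|[T CT mT]]; first by exists S => //; do !constructor.
have [ST|TS] := Ctot _ _ CS CT.
  by exists T => //; constructor=> //; exact: ST.
by exists S => //; constructor=> //; apply: List.Forall_impl mT => x; exact: TS.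
Qed.

Section Maximal.
Variables (p0 : A) (U : set A).
Hypothesis U_consistent : consistent p0 U.
Hypothesis U_maximal : forall S, U `<` S -> ~ consistent p0 S.

Let not_both p q : U p -> U q -> (forall x, on p (on q x) = zero) -> False.
Proof.
move=> Up Uq pq0; apply: (U_consistent (l := [:: p; q])); last exact: pq0.
by do !constructor.
Qed.

(** Adding p breaks consistency, and since [on p] is idempotent and commutes
    with the other restrictions, p need be used only once. *)
Let on_cut_zero p : ~ U p ->
  exists2 l, List.Forall U l & on p (cut l p0) = zero.
Proof.
move=> Up.
have /existsNP[l /not_implyP[lU /contrapT l0]] :
    ~ consistent p0 (U `|` [set p]).
  by apply: U_maximal; split=> [|sub]; [left|apply: Up; apply: sub; right].
suff [m mU lm] : exists2 m, List.Forall U m &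
    on p (cut l p0) = on p (cut m p0).
  by exists m => //; rewrite -lm l0; exact: off0.
elim: {l0} lU => [|q r [Uq|->] _ [m mU lm]]; first by exists [::].
  by exists (q :: m); [constructor|rewrite /= onC lm onC].
by exists m => //=; rewrite -lm; exact: off_idem.
Qed.

Let U_or_neg p : U p \/ U (neg p).
Proof.
apply: contrapT => /not_orP[/on_cut_zero[l lU l0] /on_cut_zero[m mU m0]].
apply: (U_consistent (l := l ++ m)); first exact/Forall_cat.
rewrite /cut foldr_cat -!/(cut _ _); apply: (@eq_cases p); last first.
  by rewrite cutC /on off_cut -/(on p _) l0 cut_zero off0.
by rewrite off_cut -on_neg m0 cut_zero off0.
Qed.

(** Each closure property fails only if two or three members of U have disjoint
    domains, against consistency. *)
Lemma maximal_ultrafilter : ultrafilter U /\ U p0.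
Proof.
have negP p : U (neg p) <-> ~ U p.
  split=> [Unp Up|]; last by case: (U_or_neg p).
  by apply: (not_both Up Unp) => x; rewrite on_neg on_off.
have U_ext p q : (forall i, anti i p = anti i q) -> U p -> U q.
  move=> pq Up; apply: contrapT => /negP; rewrite /neg -pq.
  by move/negP.
split; last first.
  apply: contrapT => /negP Unp.
  apply: (U_consistent (l := [:: neg p0])); first by do !constructor.
  by rewrite /= on_neg off_self.
split=> [i p|p q].
  rewrite -negP.
  by split; apply: U_ext => j; exact: anti_anti.
split=> [Upq|[/negP Unp Uq]]; last first.
  apply: contrapT => /negP Unpq.
  apply: (U_consistent (l := [:: neg p; q; neg (off p q)])).
    by do !constructor.
  by rewrite /= !on_neg -on_off_dom on_off.
split; first by move=> Up; apply: (not_both Upq Up) => x;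
  rewrite on_off_dom onC off_on.
apply: contrapT => /negP Unq; apply: (not_both Upq Unq) => x.
by rewrite on_off_dom on_neg on_off off0.
Qed.

End Maximal.

Lemma ultrafilter_containing p0 :
  p0 <> zero -> exists2 U, ultrafilter U & U p0.
Proof.
move=> p0_neq0.
have [C Csub Ctot|U [Ucons Umax]] := @Zorn_bigcup _ (consistent p0).
  exact: consistent_bigcup.
by have [Uu Up0] := maximal_ultrafilter Ucons Umax; exists U.
Qed.

(** * Germs *)

Section Ultra.
Variable U : set A.
Hypothesis U_ultra : ultrafilter U.

Lemma ultra_anti i p : U (anti i p) <-> ~ U p.
Proof. exact: U_ultra.1. Qed.

Lemma ultra_off p q : U (off p q) <-> ~ U p /\ U q.
Proof. exact: U_ultra.2. Qed.

Lemma ultra_on p q : U (on p q) <-> U p /\ U q.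
Proof. by rewrite ultra_off ultra_anti notE. Qed.

Lemma ultra_zero : ~ U zero.
Proof. by rewrite -(off_self zero) ultra_off => -[]. Qed.

Lemma ultra_comp (a : 'I_n -> A) b i : U (comp a b) -> U (a i).
Proof.
move=> Uab; apply: contrapT => Uai.
suff : U (off (a i) (comp a b)).
  rewrite off_comp (@comp_zero_entry _ _ i) ?off_self //; exact: ultra_zero.
by rewrite ultra_off.
Qed.

(** An equivalence on all elements; those outside U share the germ of 0. *)
Definition same_germ a b : Prop := exists2 p, U p & on p a = on p b.

Lemma same_germ_refl a : same_germ a a.
Proof.
have [Ua|] := EM (U a); first by exists a.
by rewrite -(ultra_anti i0) => Una; exists (anti i0 a).
Qed.

Lemma same_germ_sym a b : same_germ a b -> same_germ b a.
Proof. by move=> [p Up ab]; exists p. Qed.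

Lemma on_on p q x : on (on p q) x = on p (on q x).
Proof. exact: on_off_dom. Qed.

Lemma same_germ_trans a b c : same_germ a b -> same_germ b c -> same_germ a c.
Proof.
move=> [p Up ab] [q Uq bc]; exists (on p q); first exact/ultra_on.
by rewrite !on_on onC ab onC bc.
Qed.

Lemma same_germ_mem a b : same_germ a b -> U a -> U b.
Proof.
move=> [p Up ab] Ua.
suff : U (on p b) by rewrite ultra_on => -[].
by rewrite -ab ultra_on.
Qed.

Lemma same_germ_on p a : U p -> same_germ (on p a) a.
Proof. by move=> Up; exists p => //; exact: off_idem. Qed.

Lemma same_germ_off p a : ~ U p -> same_germ (off p a) a.
Proof.
by rewrite -(ultra_anti i0) -(on_neg p) => Up; exact: same_germ_on.
Qed.

Lemma ultra_meet a b : U (a .* b) <-> U a /\ same_germ a b.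
Proof.
have meetE := on_meet a b.
split=> [Uab|[Ua [p Up ab]]].
  split; first by move: Uab; rewrite -meetE ultra_on => -[].
  by exists (a .* b) => //; rewrite on_meet [in RHS]meetC on_meet meetC.
suff : U (on p (a .* b)) by rewrite ultra_on => -[].
rewrite /on /off comp_meet -!/(off _ _) -!/(on _ _) -ab meetxx.
exact/ultra_on.
Qed.

(** Finitely many agreements hold on a common domain of U. *)
Lemma same_germ_uniform (a b : 'I_n -> A) :
  (forall i, same_germ (a i) (b i)) ->
  exists2 p, U p & forall i, on p (a i) = on p (b i).
Proof.
move=> ab.
suff [p Up pP] : exists2 p, U p &
    forall i, i \in enum 'I_n -> on p (a i) = on p (b i).
  by exists p => // i; apply: pP; rewrite mem_enum.
elim: (enum 'I_n) => [|i s [p Up pP]].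
  by have [p Up _] := same_germ_refl (a i0); exists p.
have [q Uq qP] := ab i; exists (on p q); first exact/ultra_on.
move=> j; rewrite !on_on inE => /orP[/eqP->|/pP js]; first by rewrite qP.
by rewrite onC js onC.
Qed.

Lemma same_germ_comp (a b : 'I_n -> A) c :
  (forall i, same_germ (a i) (b i)) -> same_germ (comp a c) (comp b c).
Proof.
move=> /same_germ_uniform[p Up ab]; exists p => //.
rewrite /on !off_comp -!/(on _ _); congr comp; apply/funext => i; exact: ab.
Qed.

(** In the twisted law every restriction applied to a_i is by a domain in U, or
    by the complement of a domain not in U, so the germ of a_i is unchanged. *)
Lemma same_germ_comp_anti (a : 'I_n -> A) b i :
  (forall k, U (a k)) -> ~ U (comp a b) ->
  same_germ (comp a (anti i b)) (a i).
Proof.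
move=> Ua Uab; rewrite comp_anti.
apply: same_germ_trans (same_germ_off _ Uab) _.
elim: (enum 'I_n) => [|k s IHs] /=; first exact: same_germ_refl.
exact: same_germ_trans (same_germ_on _ (Ua k)) IHs.
Qed.

(** The agreement is the union of dom (a . b) and a set disjoint from dom b. *)
Lemma ultra_bowtie i a b :
  U a -> U b -> U (bowtie i a b) -> same_germ a b.
Proof.
move=> Ua Ub; rewrite ultra_anti ultra_off !ultra_anti ultra_off ultra_anti.
move=> ab; suff : U (a .* b) by rewrite ultra_meet => -[].
by apply: contrapT; tauto.
Qed.

(** Right cancellation of germs, which is injectivity of the representation: by
    the last law, where b ; a and c ; a agree, so do b_i and c_i. *)
Lemma same_germ_cancel (b c : 'I_n -> A) a i :
  U (comp b a) -> same_germ (comp b a) (comp c a) -> same_germ (b i) (c i).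
Proof.
move=> Uba ba_ca; have Uca := same_germ_mem ba_ca Uba.
apply: (@ultra_bowtie i); [exact: ultra_comp Uba|exact: ultra_comp Uca|].
apply: contrapT; rewrite -(ultra_anti i) => Unbc; apply: ultra_zero.
rewrite -(bowtie_inj i b c a) ultra_on; split=> //.
exact/ultra_meet.
Qed.

End Ultra.

(** By [eq_cases], a is determined by its restrictions inside and outside
    dom (a . b), and the former is a . b; so the latter is nonzero unless a = a . b. *)
Lemma separating_ultrafilter a b : ~ a .* b = a ->
  exists2 U, ultrafilter U & U a /\ ~ U (a .* b).
Proof.
move=> ab; have /ultrafilter_containing[U Uu Up] : off (a .* b) a <> zero.
  move=> ab0; apply: ab; apply/esym/(@eq_cases (a .* b)).
    by rewrite ab0 off_self.
  by rewrite on_meet on_self.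
by exists U => //; move: Up; rewrite (ultra_off Uu) => -[].
Qed.

(** * The representation *)

(** Admitting only the germs of members of U keeps every point in the domain
    of some function; this matters for antidomains, which range over all tuples
    of equivalent points. *)
Record point := Point {
  world : set A;
  germ : set A;
  pointP : ultrafilter world /\ exists2 a, world a & germ = same_germ world a }.

Lemma eq_point (x y : point) : world x = world y -> germ x = germ y -> x = y.
Proof.
case: x => U g P; case: y => V h Q /= UV gh; case: _ / UV in Q *.
by case: _ / gh in Q *; congr Point.
Qed.

Definition germ_at (U : set A) a (x : point) : Prop :=
  [/\ world x = U, U a & germ x = same_germ U a].

Lemma germ_at_exists U a :
  ultrafilter U -> U a -> exists x : point, germ_at U a x.
Proof.
move=> Uu Ua.
have P : ultrafilter U /\ exists2 b, U b & same_germ U a = same_germ U b.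
  by split=> //; exists a.
by exists (Point P).
Qed.

Lemma germ_atP (x : point) : exists a, germ_at (world x) a x.
Proof. by have [_ [a xa ga]] := pointP x; exists a. Qed.

Lemma germ_at_ultra U a (x : point) : germ_at U a x -> ultrafilter U.
Proof. by move=> [<- _ _]; have [] := pointP x. Qed.

Lemma germ_at_same U a b (x : point) :
  germ_at U a x -> germ_at U b x -> same_germ U a b.
Proof.
move=> xa [_ _ xb]; have Uu := germ_at_ultra xa; case: xa => _ _.
rewrite xb => ba; have : same_germ U b b := same_germ_refl Uu b.
by rewrite ba.
Qed.

Lemma germ_at_trans U a b (x : point) :
  germ_at U a x -> same_germ U a b -> germ_at U b x.
Proof.
move=> xa ab; have Uu := germ_at_ultra xa; case: xa => xU Ua xg; split=> //.
  exact: same_germ_mem ab Ua.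
rewrite xg predeqE => c; split; apply: same_germ_trans => //.
exact: same_germ_sym.
Qed.

Lemma germ_at_uniq U a (x y : point) : germ_at U a x -> germ_at U a y -> x = y.
Proof. by move=> [xU _ xa] [yU _ ya]; apply: eq_point; congruence. Qed.

Definition same_world (x y : point) : Prop := world x = world y.

Lemma same_world_equiv : Equivalence same_world.
Proof. by split=> [x|x y|x y z]; rewrite /same_world; congruence. Qed.

(** Quantifying over the representatives b makes the definition independent of
    their choice; [repE] allows any fixed choice. *)
Definition rep a : pgraph n point :=
  [set p | exists (U : set A) (b : 'I_n -> A),
     (forall i, germ_at U (b i) (p.1 i)) /\ germ_at U (comp b a) p.2].

Lemma repE U (b : 'I_n -> A) a (x : 'I_n -> point) (y : point) :
  (forall i, germ_at U (b i) (x i)) ->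
  rep a (x, y) <-> germ_at U (comp b a) y.
Proof.
move=> xb; split=> [[V [c [/= xc yc]]]|yb]; last by exists U, b.
have VU : V = U by case: (xb i0) => <- _ _; case: (xc i0).
rewrite {}VU in xc yc; apply: (germ_at_trans yc).
apply: same_germ_comp => [|i]; first exact: germ_at_ultra yc.
exact: germ_at_same (xc i) (xb i).
Qed.

Lemma coordinates (x : 'I_n -> point) : all_equivalent same_world x ->
  exists U (b : 'I_n -> A), ultrafilter U /\ forall i, germ_at U (b i) (x i).
Proof.
move=> xE; have [b xb] := choice (fun i => germ_atP (x i)).
exists (world (x i0)), b; split=> [|i]; first by have [] := pointP (x i0).
by rewrite (xE i0 i).
Qed.

Lemma rep_dom U (b : 'I_n -> A) a (x : 'I_n -> point) : ultrafilter U ->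
  (forall i, germ_at U (b i) (x i)) ->
  (exists y : point, rep a (x, y)) <-> U (comp b a).
Proof.
move=> Uu xb; split=> [[y]|/(germ_at_exists Uu)[y yb]].
  by rewrite (repE _ _ xb) => -[].
by exists y; rewrite (repE _ _ xb).
Qed.

Lemma rep_pfun a : partial_function (rep a).
Proof.
move=> x y z [U [b [/= xb yb]]]; rewrite (repE _ _ xb).
exact: germ_at_uniq yb.
Qed.

Lemma rep_inj a : injective_pfun (rep a).
Proof.
move=> x y z [U [b [/= xb zb]]] [V [c [/= yc zc]]].
have VU : V = U by case: zb => <- _ _; case: zc.
rewrite {}VU in yc zc; have Uu := germ_at_ultra zb.
apply/funext => i; apply: (germ_at_uniq (a := c i) (U := U)) (yc i).
apply: (germ_at_trans (xb i)); apply: (same_germ_cancel Uu (a := a)).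
  by case: zb.
exact: germ_at_same zb zc.
Qed.

Lemma rep_within a : within same_world (rep a).
Proof.
move=> x y [U [b [/= xb [yU _ _]]]].
have xU i : world (x i) = U by case: (xb i).
by split=> [i j|i]; rewrite /same_world ?xU.
Qed.

Lemma rep_comp (a : 'I_n -> A) b :
  rep (comp a b) = pcomp (fun i => rep (a i)) (rep b).
Proof.
rewrite predeqE => -[x z]; split.
  move=> [U [c [/= xc zc]]]; have Uu := germ_at_ultra zc.
  rewrite -comp_assoc in zc; have [_ Uc _] := zc.
  have /choice[y yP] i : exists y : point, germ_at U (comp c (a i)) y.
    by apply: germ_at_exists => //; exact: (ultra_comp Uu i Uc).
  exists y; split=> [i|]; first by rewrite (repE _ _ xc).
  by rewrite (repE _ _ yP).
move=> [y [/= xy yz]].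
have [U [c [Uu xc]]] := coordinates (rep_within (xy i0)).1.
rewrite (repE _ _ xc) -comp_assoc.
have yc i : germ_at U (comp c (a i)) (y i) by rewrite -(repE _ _ xc).
by rewrite -(repE _ _ yc).
Qed.

Lemma rep_anti i a : rep (anti i a) = panti same_world i (rep a).
Proof.
rewrite predeqE => -[x z]; split=> [xz|[/= -> xE xa]].
  have [xE _] := rep_within xz; have [U [b [Uu xb]]] := coordinates xE.
  move: xz; rewrite (repE _ _ xb) => zb; have [_ Uba _] := zb.
  have Unba : ~ U (comp b a).
    by move: Uba; rewrite comp_anti (ultra_off Uu) => -[].
  split=> //=; last by rewrite (rep_dom _ Uu xb).
  apply: germ_at_uniq (xb i); apply: (germ_at_trans zb).
  by apply: same_germ_comp_anti => // k; case: (xb k).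
have [U [b [Uu xb]]] := coordinates xE.
rewrite (repE _ _ xb); apply: (germ_at_trans (xb i)).
apply: same_germ_sym; apply: same_germ_comp_anti => // [k|].
  by case: (xb k).
by rewrite -(rep_dom _ Uu xb).
Qed.

Lemma rep_meet a b : rep (a .* b) = rep a `&` rep b.
Proof.
rewrite predeqE => -[x z]; split=> [xz|[xa xb]].
  have [U [c [Uu xc]]] := coordinates (rep_within xz).1.
  move: xz; rewrite (repE _ _ xc) comp_meet => zc; have [_ Uc _] := zc.
  have [Uca cab] := (ultra_meet Uu _ _).1 Uc.
  have cba : same_germ U (comp c a .* comp c b) (comp c a).
    by exists (comp c a .* comp c b) => //; rewrite on_self on_meet.
  split; rewrite (repE _ _ xc); first exact: germ_at_trans zc cba.
  exact: germ_at_trans zc (same_germ_trans Uu cba cab).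
have [U [c [Uu xc]]] := coordinates (rep_within xa).1.
move: xa xb; rewrite !(repE _ _ xc) comp_meet => za zb.
apply: (germ_at_trans za); apply: same_germ_sym.
exists (comp c a .* comp c b); last by rewrite on_self on_meet.
by apply/ultra_meet => //; split; [case: za|exact: germ_at_same za zb].
Qed.

(** Evaluate at the point-tuple of the projections, where the value of a is the
    germ of a itself. *)
Lemma rep_injective : injective rep.
Proof.
suff sub a b : rep a = rep b -> a .* b = a.
  by move=> a b ab; rewrite -(sub a b ab) meetC sub.
move=> ab; apply: contrapT => /separating_ultrafilter[U Uu [Ua Uab]].
pose pi (i : 'I_n) := anti i zero.
have Upi i : U (pi i) by rewrite (ultra_anti Uu); exact: ultra_zero.
have pi_comp c : comp pi c = c by exact: off_zero.
have /choice[x xP] i : exists x : point, germ_at U (pi i) x.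
  exact: germ_at_exists.
have : exists y : point, rep (a .* b) (x, y).
  by rewrite rep_meet -ab setIid (rep_dom _ Uu xP) pi_comp.
by rewrite (rep_dom _ Uu xP) pi_comp.
Qed.

Definition rep_family : pfun_family n same_world.
Proof.
refine (@PfunFamily _ _ _ (range rep) _ _ _ _ _ _).
- exact: inhabits (exist _ (rep some_elt) (imageP rep I)).
- by move=> f [a _ <-]; exact: rep_pfun.
- by move=> f [a _ <-]; exact: rep_within.
- move=> f g fP [b _ <-].
  have /choice[a aP] i : exists a, rep a = f i by case: (fP i) => a; exists a.
  exists (comp a b) => //; rewrite rep_comp; congr pcomp.
  by apply/funext => i; exact: aP.
- by move=> i f [a _ <-]; exists (anti i a) => //; exact: rep_anti.
- by move=> f g [a _ <-] [b _ <-]; exists (a .* b) => //; exact: rep_meet.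
Defined.

Lemma models_representable : injectively_representable A.
Proof.
exists point, same_world, rep_family; split.
- exact: same_world_equiv.
- by move=> f [a _ <-]; exact: rep_inj.
- pose h a : pfun_algebra rep_family := exist _ (rep a) (imageP rep I).
  exists h; split.
    split=> [a b|i a|a b]; apply: eq_exist.
    + exact: rep_comp.
    + exact: rep_anti.
    + exact: rep_meet.
  have /choice[g gh] (y : pfun_algebra rep_family) : exists a, h a = y.
    by case: y => f [a at_ fa]; exists a; apply: eq_exist.
  exists g => // a; apply: rep_injective.
  by have /(congr1 sval) := gh (h a).
Qed.

End Completeness.

Theorem corollary6p7 (n : nat) (n_ge1 : 1 <= n) :
  variety (@injectively_representable n) /\
  axiomatised_by (@injectively_representable n) (axioms n).
Proof.
pose i0 := Ordinal n_ge1.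
have repP : axiomatised_by (@injectively_representable n) (axioms n).
  move=> A; rewrite modelsP; split; last exact: (models_representable i0).
  move=> [X [E [F [E_equiv F_inj [h [h_hom h_bij]]]]]]; apply/modelsP.
  have /modelsP := pfun_models i0 E_equiv F_inj; apply: List.Forall_impl => e.
  exact: satisfies_inj h_hom (bij_inj h_bij).
by split=> //; exact: variety_of_axioms repP.
Qed.
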